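(* Let $(T(t))_{t\ge 0}$ be a $C_0$-semigroup on a separable Banach space $X$ endowed with two topologies $\tau_1$ and $\tau_2$, compatible with its linear structure, where $\tau_1$ is finer than $\tau_2$. If the semigroup is Devaney chaotic with respect to $\tau_1$, then it is Devaney chaotic with respect to $\tau_2$. The converse implication may fail: there exist such $X$, $(T(t))_{t\ge 0}$, $\tau_1$, $\tau_2$ for which the semigroup is Devaney chaotic with respect to $\tau_2$ but not with respect to $\tau_1$.
   Context: For a topology $\tau$ on $X$, the semigroup is Devaney chaotic with respect to $\tau$ if (i) there exists $x\in X$ whose orbit $\{T(t)x: t\ge 0\}$ is dense in $(X,\tau)$, and (ii) the set of periodic points $\{x\in X:\exists\, t_0>0 \text{ such that } T(t_0)x=x\}$ is dense in $(X,\tau)$. The $C_0$ property (strong continuity) refers to the norm of $X$. *)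

(* Defs.v *)
From HB Require Import structures.
From mathcomp Require Import all_boot all_order all_algebra.
From mathcomp Require Import all_classical all_reals all_analysis.
From mathcomp Require Import complex.

Set Implicit Arguments.
Unset Strict Implicit.
Unset Printing Implicit Defensive.

Import Order.TTheory GRing.Theory Num.Theory.
Import numFieldNormedType.Exports.

Local Open Scope classical_set_scope.
Local Open Scope ring_scope.

(* A topology as first-class data, so that one space can carry several. *)
Record topology (X : Type) := Topology {
  opens : set (set X) ;
  opens_setT : opens [set: X] ;
  opens_setI : setI_closed opens ;
  opens_bigcup : forall F : set (set X),
    F `<=` opens -> opens (\bigcup_(A in F) A)
}.

(* The set X seen as a topological space through tau only: for X a normed
   module, the linear structure is kept and the norm topology is dropped. *)
Definition topologized (X : Type) (tau : topology X) : Type := X.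

Section topologized_topology.
Context (X : choiceType) (tau : topology X).

Lemma opens_bigcup_indexed (I : Type) (f : I -> set X) :
  (forall i, opens tau (f i)) -> opens tau (\bigcup_i f i).
Proof.
move=> fo; rewrite -(bigcup_image [set: I] f id).
by apply: opens_bigcup => _ [i _ <-].
Qed.

HB.instance Definition _ := Choice.copy (topologized tau) X.
HB.instance Definition _ := isOpenTopological.Build (topologized tau)
  (opens_setT tau) (@opens_setI _ tau) opens_bigcup_indexed.

Lemma open_topologizedE : (open : set (set (topologized tau))) = opens tau.
Proof.
apply/seteqP; split=> A; rewrite openE => Ao; last first.
  by move=> x Ax; exists A; split.
have -> : A = \bigcup_(B in [set B | opens tau B /\ B `<=` A]) B.
  apply/seteqP; split=> x; last by move=> [B [_ BA] /BA].
  by move=> /Ao [B [oB Bx BA]]; exists B.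
by apply: opens_bigcup => B [].
Qed.

End topologized_topology.

HB.instance Definition _ (K : numFieldType) (X : lmodType K)
  (tau : topology X) := GRing.Lmodule.copy (topologized tau) X.

Definition finer (X : Type) (tau1 tau2 : topology X) : Prop :=
  opens tau2 `<=` opens tau1.

(* The conditions are those of topologicalLmodType: neither separation nor
   local convexity is required. *)
Definition linear_topology (K : numFieldType) (X : lmodType K)
    (tau : topology X) : Prop :=
  continuous (fun z : topologized tau * topologized tau => z.1 + z.2) /\
  continuous (fun z : K^o * topologized tau => z.1 *: z.2).

Definition hausdorff_topology (X : choiceType) (tau : topology X) : Prop :=
  hausdorff_space (topologized tau).

Definition separable (X : topologicalType) : Prop :=
  exists2 D : set X, countable D & dense D.

(* Time is real even when the scalars are complex, and T t is unconstrained
   for t < 0. *)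
Definition C0_semigroup (R : realType) (K : numFieldType)
    (X : normedModType K) (T : R -> X -> X) : Prop :=
  [/\ forall t, 0 <= t -> linear (T t) /\ continuous (T t),
      forall x, T 0 x = x,
      forall s t x, 0 <= s -> 0 <= t -> T (s + t) x = T s (T t x)
    & forall x, T t x @[t --> 0^'+] --> x].

Definition orbit (R : realType) (X : Type) (T : R -> X -> X) (x : X) : set X :=
  [set T t x | t in [set t | 0 <= t]].

Definition periodic_points (R : realType) (X : Type) (T : R -> X -> X)
    : set X :=
  [set x | exists2 t0, 0 < t0 & T t0 x = x].

Definition Devaney_chaotic (R : realType) (X : choiceType) (tau : topology X)
    (T : R -> X -> X) : Prop :=
  (exists x, @dense (topologized tau) (orbit T x)) /\
  @dense (topologized tau) (periodic_points T).

(* Main.v *)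
(* Chaos passes to a coarser topology because dense sets stay dense.

   For the converse, take X = C([0, 1], K) with the sup norm and the dilation
   semigroup (T(t) u)(s) = exp(t) u(exp(-t) s). Let tau1 be pointwise convergence
   on [0, 1] and tau2 pointwise convergence on ]0, 1]; both are Hausdorff by
   continuity. Every periodic point vanishes at 0, where evaluation is
   tau1-continuous, so T is not chaotic for tau1. For tau2 the behaviour near 0 is
   invisible: placing copies a_k g_k(s / a_k) of prescribed patterns g_k in
   disjoint intervals shrinking to 0 gives a continuous function u with
   T(- ln a_k) u = g_k away from 0. Running g_k through a dense sequence gives a
   dense orbit, and a_k = a^k with g_k constant gives a periodic point close to
   any given function. *)
Require Import Defs.
From HB Require Import structures.
From mathcomp Require Import all_boot all_order all_algebra.
From mathcomp Require Import all_classical all_reals all_analysis.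
From mathcomp Require Import complex.
From mathcomp Require Import ring lra.

Set Implicit Arguments.
Unset Strict Implicit.
Unset Printing Implicit Defensive.

Import Order.TTheory GRing.Theory Num.Theory.
Import numFieldNormedType.Exports.

Local Open Scope classical_set_scope.
Local Open Scope ring_scope.

(** Common interface to the real and complex cases. The norm of a [numFieldType] takes values in the
    field itself, while suprema and estimates are taken in [R]; [mag] is its real-valued form. The
    last two fields are what makes C([0, 1], K) complete and separable. *)
Record real_magnitude (R : realType) (K : numFieldType) := RealMagnitude {
  emb : {rmorphism R -> K} ;
  mag : K -> R ;
  le_emb : {mono emb : x y / x <= y} ;
  norm_mag : forall z, `|z| = emb (mag z) ;
  scalar_complete : forall F : set_system K,
    ProperFilter F -> cauchy F -> cvg F ;
  scalar_separable : exists q : nat -> K,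
    forall z e, 0 < e -> exists n, mag (z - q n) < e
}.

(** * Calculus of the real-valued modulus *)

Section mag_theory.
Context (R : realType) (K : numFieldType) (S : real_magnitude R K).
Local Notation emb := (emb S).
Local Notation mag := (mag S).

Lemma emb_inj : injective emb.
Proof. exact: fmorph_inj. Qed.

Lemma lt_emb : {mono emb : x y / x < y}.
Proof. by move=> x y; rewrite !lt_neqAle le_emb (inj_eq emb_inj). Qed.

Lemma mag_ge0 z : 0 <= mag z.
Proof. by rewrite -(le_emb S) rmorph0 -(norm_mag S). Qed.

Lemma mag_emb r : mag (emb r) = `|r|.
Proof.
apply: emb_inj; rewrite -(norm_mag S).
have [r0|r0] := leP 0 r.
  by rewrite !ger0_norm// -(rmorph0 emb) le_emb.
by rewrite !ltr0_norm ?rmorphN// -(rmorph0 emb) lt_emb.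
Qed.

Lemma mag0 : mag 0 = 0.
Proof. by rewrite -(rmorph0 emb) mag_emb normr0. Qed.

Lemma mag1 : mag 1 = 1.
Proof. by rewrite -(rmorph1 emb) mag_emb normr1. Qed.

Lemma mag_eq0 z : mag z = 0 -> z = 0.
Proof. by move=> z0; apply/normr0_eq0; rewrite (norm_mag S) z0 rmorph0. Qed.

Lemma magM x y : mag (x * y) = mag x * mag y.
Proof. by apply: emb_inj; rewrite rmorphM -!(norm_mag S) normrM. Qed.

Lemma magD x y : mag (x + y) <= mag x + mag y.
Proof. by rewrite -(le_emb S) rmorphD -!(norm_mag S) ler_normD. Qed.

Lemma magN x : mag (- x) = mag x.
Proof. by apply: emb_inj; rewrite -!(norm_mag S) normrN. Qed.

Lemma mag_distC x y : mag (x - y) = mag (y - x).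
Proof. by rewrite -magN opprB. Qed.

Lemma mag_distD y x z : mag (x - z) <= mag (x - y) + mag (y - z).
Proof. by apply: le_trans (magD _ _); rewrite addrA subrK. Qed.

Lemma mag_sum n (F : nat -> K) :
  mag (\sum_(i < n) F i) <= \sum_(i < n) mag (F i).
Proof.
elim: n => [|n IH]; first by rewrite !big_ord0 mag0.
by rewrite !big_ord_recr/= (le_trans (magD _ _))// lerD2r.
Qed.

(** A positive scalar equals its own norm, so it is real. This turns every epsilon in [K] into one
    in [R]. *)
Lemma pos_emb (e : K) : 0 < e -> exists2 r, 0 < r & e = emb r.
Proof.
move=> e0; exists (mag e); last by rewrite -(norm_mag S) gtr0_norm.
by rewrite -lt_emb rmorph0 -(norm_mag S) normr_gt0 gt_eqF.
Qed.

Lemma cvg_magP (T : Type) (F : set_system T) (FF : Filter F) (f : T -> K) l :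
  f @ F --> l <-> forall e, 0 < e -> \forall x \near F, mag (l - f x) < e.
Proof.
split=> [/cvgrPdist_lt fl e e0|fl].
  have /fl : 0 < emb e by rewrite -(rmorph0 emb) lt_emb.
  by apply: filterS => x; rewrite (norm_mag S) lt_emb.
apply/cvgrPdist_lt => _ /pos_emb[e e0 ->].
by apply: filterS (fl _ e0) => x; rewrite (norm_mag S) lt_emb.
Qed.

Lemma continuous_magP (f : R -> K) :
  continuous f <-> forall s e, 0 < e -> exists2 d, 0 < d &
    forall t, `|s - t| < d -> mag (f s - f t) < e.
Proof.
split=> [cf s e e0|cf s].
  have fs := (cvg_magP (nbhs_filter s) f (f s)).1 (cf s) _ e0.
  have [d /= d0 sub] := (nbhs_ballP s (fun t => mag (f s - f t) < e)).1 fs.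
  by exists d => // t st; exact: sub.
apply/cvg_magP => e e0; have [d d0 sub] := cf s _ e0.
by apply/nbhs_ballP; exists d => //= t; exact: sub.
Qed.

Lemma continuous_emb : continuous emb.
Proof.
apply/continuous_magP => s e e0; exists e => // t.
by rewrite -rmorphB mag_emb.
Qed.

Lemma continuous_mag : continuous mag.
Proof.
move=> z; apply/(@cvgrPdist_lt _ _ _ _ (nbhs_filter z)) => e e0.
have zz : (fun y : K => y) @ nbhs z --> z by exact: cvg_id.
have := (@cvg_magP K (nbhs z) (nbhs_filter z) (fun y => y) z).1 zz _ e0.
apply: filterS => y; apply: le_lt_trans.
rewrite ler_norml; apply/andP; split.
  by have := magD (y - z) z; rewrite subrK mag_distC; lra.
by have := magD (z - y) y; rewrite subrK; lra.
Qed.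

(** Serves twice: for the completeness of C([0, 1], K) and for the continuity of glued functions. *)
Lemma uniform_limit_continuous_mag (f : R -> K) :
  (forall e, 0 < e -> exists2 g : R -> K, continuous g &
    forall s, mag (f s - g s) <= e) -> continuous f.
Proof.
move=> fg; apply/continuous_magP => s e e0.
have e4 : 0 < e / 4 by lra.
have [g cg gf] := fg _ e4.
have [d d0 sub] := (continuous_magP g).1 cg s _ e4.
exists d => // t /sub gst.
have := mag_distD (g s) (f s) (f t); have := mag_distD (g t) (g s) (f t).
have := gf s; have := gf t; rewrite (mag_distC (f t)); lra.
Qed.

End mag_theory.

(** * The two instances: real and complex scalars *)

Section real_complex_scalars.
Context (R : realType).

Definition real_self_magnitude : real_magnitude R (R : numFieldType).
Proof.
apply: (@RealMagnitude R R idfun Num.norm) => //.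
  exact: R_complete.
(* The rationals are enumerated by [unpickle], with 0 at the integers that code none. *)
exists (fun n => ratr (odflt 0 (unpickle n))) => z e e0.
have zz : z - e < z + e by lra.
have [q /=] := rat_in_itvoo zz; rewrite in_itv/= => /andP[q1 q2].
exists (pickle q); rewrite pickleK/= ltr_norml; apply/andP; split; lra.
Defined.

Lemma complex_mag_ge_Re (z : R[i]%C) : `|complex.Re z| <= complex.Re `|z|.
Proof. by have := normc_ge_Re z; rewrite lecE => /andP[]. Qed.

Lemma complex_mag_ge_Im (z : R[i]%C) : `|complex.Im z| <= complex.Re `|z|.
Proof.
by rewrite normc_def/= -sqrtr_sqr ler_wsqrtr// lerDr sqr_ge0.
Qed.

Lemma complex_mag_le (z : R[i]%C) :
  complex.Re `|z| <= `|complex.Re z| + `|complex.Im z|.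
Proof.
rewrite normc_def/= -[leRHS]ger0_norm ?addr_ge0// -sqrtr_sqr ler_wsqrtr//.
rewrite sqrrD !real_normK ?num_real//.
by have := normr_ge0 (complex.Re z); have := normr_ge0 (complex.Im z); nra.
Qed.

Lemma complex_norm_Re (z : R[i]%C) : `|z| = (complex.Re `|z|)%:C%C.
Proof. by rewrite normc_def. Qed.

Lemma complex_complete (F : set_system (R[i]%C : numFieldType)) :
  ProperFilter F -> cauchy F -> cvg F.
Proof.
move=> FF /cauchyP Fc.
(* A coordinate map is additive and 1-Lipschitz, so it sends Cauchy filters to Cauchy filters of
   [R]. *)
have part (p : R[i]%C -> R) : (forall z w, p (z - w) = p z - p w) ->
    (forall z, `|p z| <= complex.Re `|z|) -> cvg (p @ F).
  move=> pB ple; apply: R_complete; apply/cauchyP => e e0.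
  have : 0 < e%:C%C by rewrite ltcR.
  move=> /Fc[x Fx]; exists (p x).
  suff : F [set z | `|p x - p z| < e] by [].
  apply: filterS Fx => y xy /=.
  have : `|x - y| < e%:C%C by exact: xy.
  rewrite complex_norm_Re ltcR; apply: le_lt_trans.
  by rewrite -pB.
have /cvg_ex[a Fa] := part _ (fun z w => raddfB _ z w) complex_mag_ge_Re.
have /cvg_ex[b Fb] := part _ (fun z w => raddfB _ z w) complex_mag_ge_Im.
apply/cvg_ex; exists (a +i* b)%C; apply/cvgrPdist_lt => e.
(* Positivity in the order of [R[i]] forces the imaginary part of the radius to vanish. *)
case: e => e1 e2; rewrite ltcE/= => /andP[/eqP -> e0].
have e20 : 0 < e1 / 2 by lra.
have Fa' := (cvgrPdist_lt _ _).1 Fa _ e20.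
have Fb' := (cvgrPdist_lt _ _).1 Fb _ e20.
near=> z.
have az : `|a - complex.Re z| < e1 / 2 by near: z; exact: Fa'.
have bz : `|b - complex.Im z| < e1 / 2 by near: z; exact: Fb'.
rewrite complex_norm_Re ltcR; apply: le_lt_trans (complex_mag_le _) _.
by rewrite !raddfB/=; lra.
Unshelve. all: by end_near. Qed.

Definition real_complex_magnitude : real_magnitude R (R[i]%C : numFieldType).
Proof.
apply: (@RealMagnitude R (R[i]%C : numFieldType) (real_complex R)
  (fun z => complex.Re `|z|)).
- exact: lecR.
- exact: complex_norm_Re.
- exact: complex_complete.
pose q n := odflt 0 (unpickle n : option (rat * rat)).
exists (fun n => ratr (q n).1 +i* ratr (q n).2)%C => z e e0.
have approx x : exists2 r : rat, x - e / 2 < ratr r & ratr r < x + e / 2.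
  have xx : x - e / 2 < x + e / 2 by lra.
  by have [r /=] := rat_in_itvoo xx; rewrite in_itv/= => /andP[]; exists r.
have [a a1 a2] := approx (complex.Re z).
have [b b1 b2] := approx (complex.Im z).
exists (pickle (a, b)); rewrite /q pickleK/=.
apply: le_lt_trans (complex_mag_le _) _; rewrite !raddfB/=.
have : `|complex.Re z - ratr a| < e / 2.
  by rewrite ltr_norml; apply/andP; split; lra.
have : `|complex.Im z - ratr b| < e / 2.
  by rewrite ltr_norml; apply/andP; split; lra.
lra.
Defined.

End real_complex_scalars.

(** * Retraction of the line onto [0, 1] *)

Section clamp.
Context (R : realType).
Implicit Types s t : R.

Definition clamp s : R := Num.max 0 (Num.min 1 s).

Lemma clampP s : 0 <= clamp s <= 1.
Proof. by rewrite /clamp le_max lexx/= ge_max ler01/= ge_min lexx. Qed.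

Lemma clamp_id s : 0 <= s <= 1 -> clamp s = s.
Proof. by rewrite /clamp => /andP[? ?]; rewrite min_r// max_r. Qed.

Lemma clamp_idem s : clamp (clamp s) = clamp s.
Proof. exact/clamp_id/clampP. Qed.

Lemma clamp_gt0 s : 0 < s -> 0 < clamp s.
Proof. by rewrite /clamp lt_max lt_min ltr01 => ->; rewrite orbT. Qed.

Lemma clamp_eq0 s : s <= 0 -> clamp s = 0.
Proof. by move=> s0; rewrite /clamp max_l// ge_min s0 orbT. Qed.

Lemma clamp_eq1 s : 1 <= s -> clamp s = 1.
Proof. by move=> s1; rewrite /clamp min_l// max_r. Qed.

Lemma clamp_lip s t : `|clamp s - clamp t| <= `|s - t|.
Proof.
have cases u : [\/ u <= 0 /\ clamp u = 0, 0 <= u <= 1 /\ clamp u = u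
    | 1 <= u /\ clamp u = 1].
  have [u0|u0] := leP u 0; first by apply: Or31; rewrite clamp_eq0.
  have [u1|u1] := leP 1 u; first by apply: Or33; rewrite clamp_eq1.
  by apply: Or32; rewrite clamp_id ?(ltW u0) ?(ltW u1).
have := ler_norm (s - t); have := ler_norm (t - s); rewrite (distrC t) => h1 h2.
rewrite ler_norml.
case: (cases s) => -[hs ->]; case: (cases t) => -[ht ->];
  apply/andP; split; lra.
Qed.

Lemma continuous_clamp : continuous clamp.
Proof.
move=> s; apply/cvgrPdist_lt => e e0; apply/nbhs_ballP; exists e => //= t.
exact/le_lt_trans/clamp_lip.
Qed.

End clamp.

(** * The Banach space C([0, 1], K) *)

Definition unit_interval_fun (R : realType) (K : numFieldType)
    : {pred (R -> K)} :=
  [pred f : R -> K | `[< continuous f /\ forall s, f (clamp s) = f s >]].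

Arguments unit_interval_fun : clear implicits.

Lemma unit_interval_fun_submod_closed (R : realType) (K : numFieldType) :
  submod_closed (unit_interval_fun R K).
Proof.
split; first by apply/asboolP; split=> // s; exact: cvg_cst.
move=> k f g /asboolP[cf ff] /asboolP[cg gg]; apply/asboolP; split=> s.
  by apply: cvgD; [apply: cvgM; [exact: cvg_cst|exact: cf]|exact: cg].
by rewrite !fctE ff gg.
Qed.

HB.instance Definition _ (R : realType) (K : numFieldType) :=
  GRing.isSubmodClosed.Build K (R -> K) (unit_interval_fun R K)
    (@unit_interval_fun_submod_closed R K).

(* C([0, 1], K): a function on [0, 1] is stored as its extension to R that is
   constant on each side of [0, 1]. *)
Record C01 (R : realType) (K : numFieldType) (S : real_magnitude R K) := MkC01 {
  C01_fun :> R -> K ;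
  C01_funP : C01_fun \in unit_interval_fun R K
}.

Section C01_lmod.
Context (R : realType) (K : numFieldType) (S : real_magnitude R K).

HB.instance Definition _ := [isSub for @C01_fun R K S].
HB.instance Definition _ := [Choice of C01 S by <:].
HB.instance Definition _ := [SubChoice_isSubLmodule of C01 S by <:].

Implicit Types (f g u v : C01 S) (s t : R).

Lemma C01_continuous f : continuous f.
Proof. by have /asboolP[] := C01_funP f. Qed.

Lemma C01_clamp f s : f (clamp s) = f s.
Proof. by have /asboolP[] := C01_funP f. Qed.

Lemma C01D f g s : (f + g) s = f s + g s. Proof. by []. Qed.
Lemma C01B f g s : (f - g) s = f s - g s. Proof. by []. Qed.
Lemma C01Z k f s : (k *: f) s = k * f s. Proof. by []. Qed.

Lemma C01_ext f g : f =1 g -> f = g.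
Proof. by move=> fg; apply/val_inj/funext. Qed.

Lemma restrict_proof (h : R -> K) (ch : continuous h) :
  h \o @clamp R \in unit_interval_fun R K.
Proof.
apply/asboolP; split=> [s|s /=]; last by rewrite clamp_idem.
by apply: continuous_comp; [exact: continuous_clamp|exact: ch].
Qed.

Definition restrict01 h (ch : continuous h) : C01 S :=
  MkC01 S (restrict_proof ch).

(** The sup norm as a real number: by clamping, the supremum over the whole line is the one over
    [0, 1]. *)
Definition sup_mag f : R := sup [set mag S (f s) | s in setT].

Lemma sup_mag_has_sup f : has_sup [set mag S (f s) | s in setT].
Proof.
split; first by exists (mag S (f 0)), 0.
have cmf : {within `[0, 1 : R], continuous (mag S \o f)}.
  apply: continuous_subspaceT => s.
  by apply: continuous_comp; [exact: C01_continuous|exact: continuous_mag].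
have [c _ cmax] := EVT_max ler01 cmf.
exists (mag S (f c)) => _ [s _ <-]; rewrite -C01_clamp.
by apply: cmax; rewrite in_itv/= clampP.
Qed.

Lemma sup_mag_ge f s : mag S (f s) <= sup_mag f.
Proof.
apply: sup_upper_bound; first exact: sup_mag_has_sup.
by exists s.
Qed.

Lemma sup_mag_ge0 f : 0 <= sup_mag f.
Proof. exact: le_trans (mag_ge0 S (f 0)) (sup_mag_ge f 0). Qed.

Lemma sup_mag_le f e : (forall s, 0 <= s <= 1 -> mag S (f s) <= e) ->
  sup_mag f <= e.
Proof.
move=> fe; apply: ge_sup; first by case: (sup_mag_has_sup f).
by move=> _ [s _ <-]; rewrite -C01_clamp; exact/fe/clampP.
Qed.

Definition C01_norm f : K := emb S (sup_mag f).

Lemma C01_ler_normD f g : C01_norm (f + g) <= C01_norm f + C01_norm g.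
Proof.
rewrite /C01_norm -rmorphD le_emb; apply: sup_mag_le => s _.
by rewrite C01D (le_trans (magD _ _ _))// lerD// sup_mag_ge.
Qed.

Lemma sup_magZ k f : sup_mag (k *: f) = mag S k * sup_mag f.
Proof.
have le k' f' : sup_mag (k' *: f') <= mag S k' * sup_mag f'.
  apply: sup_mag_le => s _.
  by rewrite C01Z magM ler_wpM2l ?mag_ge0 ?sup_mag_ge.
have [->|k0] := eqVneq k 0.
  apply/eqP; rewrite eq_le le/= mag0 mul0r.
  exact: sup_mag_ge0.
apply/eqP; rewrite eq_le le/=.
have mk0 : 0 < mag S k.
  rewrite lt_neqAle mag_ge0 andbT eq_sym.
  by apply/eqP => /mag_eq0 k00; rewrite k00 eqxx in k0.
(* The reverse inequality is the one just proved, applied to the inverse scalar. *)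
have := le k^-1 (k *: f); rewrite scalerA mulVf// scale1r.
have -> : mag S k^-1 = (mag S k)^-1.
  by apply: (mulfI (lt0r_neq0 mk0)); rewrite -magM mulfV// mag1 mulfV// lt0r_neq0.
by rewrite ler_pdivlMl.
Qed.

Lemma C01_normZ k f : C01_norm (k *: f) = `|k| * C01_norm f.
Proof. by rewrite /C01_norm sup_magZ rmorphM (norm_mag S). Qed.

Lemma C01_norm0_eq0 f : C01_norm f = 0 -> f = 0.
Proof.
rewrite /C01_norm -(rmorph0 (emb S)) => /emb_inj f0.
apply: C01_ext => s; apply: (mag_eq0 (S := S)); apply/eqP.
by rewrite eq_le mag_ge0 andbT -f0 sup_mag_ge.
Qed.

HB.instance Definition _ := Lmodule_isNormed.Build K (C01 S)
  C01_ler_normD C01_normZ C01_norm0_eq0.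

Lemma C01_normE f : `|f| = emb S (sup_mag f).
Proof. by []. Qed.

Lemma C01_complete (F : set_system (C01 S)) :
  ProperFilter F -> cauchy F -> cvg F.
Proof.
move=> FF /cauchyP Fc.
have ball_supE (g h : C01 S) e : ball g (emb S e) h = (sup_mag (g - h) < e).
  by rewrite -ball_normE /ball_/= C01_normE lt_emb.
have {}Fc e : 0 < e -> exists g, F [set h | sup_mag (g - h) < e].
  move=> e0; have : 0 < emb S e by rewrite -(rmorph0 (emb S)) lt_emb.
  by move=> /Fc[g Fg]; exists g; apply: filterS Fg => h; rewrite ball_supE.
have evF s : exists l : K, (fun g : C01 S => g s) @ F --> l.
  suff /cvg_ex[l ?] : cvg ((fun g : C01 S => g s) @ F) by exists l.
  apply: (scalar_complete S); apply/cauchyP => _ /(pos_emb S)[e e0 ->].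
  have [g Fg] := Fc _ e0; exists (g s).
  suff : F [set h | `|g s - h s| < emb S e] by [].
  apply: filterS Fg => h /=; rewrite (norm_mag S) lt_emb.
  exact/le_lt_trans/(sup_mag_ge (g - h)).
pose l s := projT1 (cid (evF s)).
have lP s : (fun g : C01 S => g s) @ F --> l s by rewrite /l; case: cid.
(* At each [s], some [h] is both uniformly close to [g] and close to the limit at [s]. Since the
   second error [d] is arbitrary, the resulting bound does not depend on [s]. *)
have near_l e : 0 < e -> exists2 g : C01 S, F [set h | sup_mag (g - h) < e]
    & forall s, mag S (l s - g s) <= e.
  move=> e0; have [g Fg] := Fc _ e0; exists g => // s.
  apply/ler_addgt0Pr => d d0.
  have Fl := (cvg_magP S FF (fun g : C01 S => g s) (l s)).1 (lP s) _ d0.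
  have [h [/= h1 h2]] := filter_ex (filterI Fg Fl).
  have := mag_distD S (h s) (l s) (g s); rewrite (mag_distC S (h s)).
  have := sup_mag_ge (g - h) s; rewrite C01B; lra.
have cl : continuous l.
  apply: (uniform_limit_continuous_mag (S := S)) => e /near_l[g _ gl].
  by exists g => //; exact: C01_continuous.
have lc s : l (clamp s) = l s.
  have := lP (clamp s); rewrite (_ : (fun _ => _) = (fun g : C01 S => g s)).
    by move=> /(cvg_unique (@norm_hausdorff _ _)); apply; exact: lP.
  by apply/funext => g; rewrite C01_clamp.
apply/cvg_ex; exists (restrict01 cl).
apply/cvgrPdist_lt => _ /(pos_emb S)[e e0 ->].
have [g Fg gl] : exists2 g : C01 S, F [set h | sup_mag (g - h) < e / 4]
  & forall s, mag S (l s - g s) <= e / 4 by apply: near_l; lra.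
apply: filterS Fg => h /= gh; rewrite C01_normE lt_emb.
apply: (@le_lt_trans _ _ (e / 2)); last lra.
apply: sup_mag_le => s _; rewrite C01B /= lc.
have := mag_distD S (g s) (l s) (h s); have := gl s.
have := sup_mag_ge (g - h) s; rewrite C01B; lra.
Qed.

HB.instance Definition _ := Uniform_isComplete.Build (C01 S) C01_complete.


(** Heine-Cantor through near coverings: the radii run along the filter [0^'+], so compactness
    yields one radius for the whole segment, and [clamp_lip] extends the estimate to the line. *)
Lemma C01_unif_continuous f e : 0 < e -> exists2 d, 0 < d &
  forall s t, `|s - t| < d -> mag S (f s - f t) < e.
Proof.
move=> e0.
have := (compact_near_coveringP _).1 (@segment_compact R 0 1) R (0^'+)
  (fun d s => forall t, `|s - t| < d -> mag S (f s - f t) < e) _.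
case=> [s _|d /= d0 sub].
  have e2 : 0 < e / 2 by lra.
  have [d d0 fd] := (continuous_magP S f).1 (@C01_continuous f) s _ e2.
  exists ([set s' | `|s - s'| < d / 2], [set d' | d' < d / 2]).
    split=> /=.
      by apply/nbhs_ballP; exists (d / 2) => //=; lra.
    by apply: nbhs_right_lt; lra.
  move=> [s' d'] /= [ss' d'd] t s't.
  have := mag_distD S (f s) (f s') (f t); rewrite (mag_distC S (f s') (f s)).
  have : `|s - s'| < d by lra.
  move=> /fd; have : `|s - t| < d by have := ler_distD s' s t; lra.
  by move=> /fd; lra.
have d2 : 0 < d / 2 by rewrite /= in d0; lra.
exists (d / 2) => // s t st; rewrite -(C01_clamp f s) -(C01_clamp f t).
have := sub (d / 2); rewrite /= sub0r normrN gtr0_norm//.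
move=> /(_ _ d2 (clamp s))/=; rewrite in_itv/= clampP; apply => //; first lra.
exact: le_lt_trans (clamp_lip _ _) st.
Qed.

End C01_lmod.

(** * Topologies of pointwise convergence *)

Section pointwise_topology.
Context (R : realType) (K : numFieldType) (S : real_magnitude R K).
Implicit Types (A : set R) (u v : C01 S) (s t : R).

(** The initial topology of the evaluations at points of [A], given by basic neighbourhoods. Points
    outside [0, 1] are evaluated through clamping, so [A] = [setT] amounts to [0, 1] and the
    positive reals amount to ]0, 1]. *)
Definition ptws_opens A : set (set (C01 S)) :=
  [set U | forall u, U u -> exists (F : seq R) (e : R),
    [/\ 0 < e, forall s, s \in F -> A s &
      forall v, (forall s, s \in F -> mag S (u s - v s) < e) -> U v]].

Lemma ptws_opensT A : ptws_opens A setT.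
Proof. by move=> u _; exists [::], 1. Qed.

Lemma ptws_opensI A : setI_closed (ptws_opens A).
Proof.
move=> U V oU oV u [/oU[F [e [e0 FA eU]]] /oV[G [d [d0 GA dV]]]].
exists (F ++ G), (Num.min e d); split.
- by rewrite lt_min e0.
- by move=> s; rewrite mem_cat => /orP[/FA|/GA].
- move=> v uv; split; [apply: eU|apply: dV] => s sF;
  by have := uv s; rewrite mem_cat sF ?orbT => /(_ isT); rewrite lt_min => /andP[].
Qed.

Lemma ptws_opens_bigcup A (F : set (set (C01 S))) :
  F `<=` ptws_opens A -> ptws_opens A (\bigcup_(U in F) U).
Proof.
move=> FA u [U FU /(FA _ FU)[G [e [e0 GA eU]]]]; exists G, e; split => // v uv.
by exists U => //; exact: eU.
Qed.

Definition ptws A : topology (C01 S) :=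
  Topology (@ptws_opensT A) (@ptws_opensI A) (@ptws_opens_bigcup A).

Lemma ptws_finer A B : A `<=` B -> finer (ptws B) (ptws A).
Proof.
move=> AB U oU u /oU[F [e [e0 FA eU]]]; exists F, e; split => // s /FA.
exact: AB.
Qed.

Lemma open_ptws A (U : set (C01 S)) :
  @open (topologized (ptws A)) U <-> ptws_opens A U.
Proof. by rewrite open_topologizedE. Qed.

Definition eval_at A s (u : topologized (ptws A)) : K := (u : C01 S) s.

Lemma continuous_eval_at A s : A s -> continuous (@eval_at A s).
Proof.
move=> As u; apply/(cvg_magP S (nbhs_filter u)) => e e0.
rewrite nbhsE /=; exists [set v : C01 S | mag S (u s - v s) < e] => //.
split; last by rewrite /= subrr mag0.
apply/open_ptws => v /= uv; exists [:: s], (e - mag S (u s - v s)); split.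
- by rewrite subr_gt0.
- by move=> t; rewrite inE => /eqP ->.
- move=> w /(_ s); rewrite inE eqxx => /(_ isT).
  by have := mag_distD S (v s) (u s) (w s); lra.
Qed.

(** A basic neighbourhood imposes finitely many conditions, each of them met eventually. Continuity
    of the linear operations is thereby reduced to scalars. *)
Lemma cvg_ptws A (F : set_system (topologized (ptws A))) (FF : Filter F)
    (u : topologized (ptws A)) :
  (forall s, A s -> @eval_at A s @ F --> eval_at s u) -> F --> u.
Proof.
move=> Fu V; rewrite nbhsE => -[U [/open_ptws oU Uu] UV].
have [G [e [e0 GA eU]]] := oU _ Uu.
suff : F [set v | forall s, s \in G -> mag S (eval_at s u - eval_at s v) < e].
  by apply: filterS => v uv; apply/UV/eU.
elim: G GA {eU} => [_|s G IH GA]; first by apply: filterE.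
have As : A s by apply: GA; rewrite mem_head.
have Fs := (cvg_magP S FF (@eval_at A s) (eval_at s u)).1 (Fu _ As) _ e0.
have {}IH := IH (fun t tG => GA t (mem_behead (s := s :: G) tG)).
apply: filterS2 Fs IH => v vs vG t; rewrite inE => /predU1P[->//|]; exact: vG.
Qed.

Lemma ptws_linear A : linear_topology (ptws A).
Proof.
split=> -[x y]; apply: cvg_ptws => s As.
  have ex : eval_at s z.1 @[z --> (x, y)] --> eval_at s x.
    by apply: cvg_comp; [exact: cvg_fst|exact: (continuous_eval_at As)].
  have ey : eval_at s z.2 @[z --> (x, y)] --> eval_at s y.
    by apply: cvg_comp; [exact: cvg_snd|exact: (continuous_eval_at As)].
  exact: (cvgD ex ey).
have ex : z.1 @[z --> (x, y)] --> x by exact: cvg_fst.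
have ey : eval_at s z.2 @[z --> (x, y)] --> eval_at s y.
  by apply: cvg_comp; [exact: cvg_snd|exact: (continuous_eval_at As)].
exact: (cvgM ex ey).
Qed.

(** Functions that agree on ]0, 1] agree at 0 by continuity, so ignoring the value at 0 still
    separates points. *)
Lemma ptws_hausdorff A : (forall s, 0 < s -> A s) -> hausdorff_topology (ptws A).
Proof.
move=> A0 u v uv.
have uvA s : A s -> (u : C01 S) s = (v : C01 S) s.
  move=> As; apply: (@norm_hausdorff K K) => U V.
  move=> /(continuous_eval_at As) Uu /(continuous_eval_at As) Vv.
  by have [w [Uw Vw]] := uv _ _ Uu Vv; exists (eval_at s w).
have uv0 : (u : C01 S) 0 = (v : C01 S) 0.
  apply/eqP; rewrite -subr_eq0; apply/eqP/(mag_eq0 (S := S))/eqP.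
  rewrite eq_le mag_ge0 andbT; apply/ler_addgt0Pr => e e0; rewrite add0r.
  have [d d0 uvd] := (continuous_magP S _).1
    (@C01_continuous _ _ S ((u : C01 S) - (v : C01 S))) 0 _ e0.
  have d2 : 0 < d / 2 by lra.
  have := uvd (d / 2); rewrite sub0r normrN gtr0_norm// !C01B (uvA (d / 2)).
    by rewrite subrr subr0 => /(_ _)/ltW; apply; lra.
  exact: A0.
apply: C01_ext => s; have [s0|/A0/uvA//] := leP s 0.
by rewrite -(C01_clamp u) -(C01_clamp v) clamp_eq0.
Qed.

(** A basic neighbourhood tests finitely many positive points, and these stay at some distance [d]
    from 0; approximation on [d, 1] is therefore enough. *)
Lemma dense_ptws_pos (D : set (C01 S)) :
  (forall u d e, 0 < d -> 0 < e ->
    exists2 v, D v & forall s, d <= s <= 1 -> mag S (u s - v s) < e) ->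
  @dense (topologized (ptws [set s | 0 < s])) D.
Proof.
move=> approx U [u Uu] /open_ptws /(_ _ Uu)[F [e [e0 F0 eU]]].
have [d [d0 Fd]] : exists d : R, 0 < d /\ forall s, s \in F -> d <= clamp s.
  elim: F F0 {eU} => [_|s F IH F0]; first by exists 1.
  have [t tF|d [d0 Fd]] := IH _; first by apply: F0; rewrite inE tF orbT.
  have s0 : 0 < clamp s by apply/clamp_gt0/F0; rewrite mem_head.
  exists (Num.min (clamp s) d); split; first by rewrite lt_min s0.
  by move=> t; rewrite inE ge_min => /predU1P[->|/Fd ->]; rewrite ?lexx ?orbT.
have [v Dv uv] := approx u d e d0 e0.
exists v; split=> //; apply: eU => s /Fd ds.
by rewrite -(C01_clamp u) -(C01_clamp v) uv// ds; case/andP: (clampP s).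
Qed.

End pointwise_topology.

(** * The dilation semigroup and its strong continuity *)

Section dilation_semigroup.
Context (R : realType) (K : numFieldType) (S : real_magnitude R K).
Implicit Types (u v : C01 S) (s t : R).

Lemma dilation_continuous t u :
  continuous (fun s => emb S (expR t) * u (expR (- t) * s)).
Proof.
move=> s; apply: cvgM; first exact: cvg_cst.
apply: (@cvg_comp _ _ _ _ (fun y => u y)); last exact: C01_continuous.
by apply: cvgM; [exact: cvg_cst|exact: cvg_id].
Qed.

(** For nonnegative [t] the argument stays in [0, 1]. For negative [t] it may exceed 1, where the
    constant extension of [u] is read. *)
Definition dilation t u : C01 S := restrict01 S (@dilation_continuous t u).

Lemma dilationE t u s :
  dilation t u s = emb S (expR t) * u (expR (- t) * clamp s).
Proof. by []. Qed.

Lemma expRN_clamp t s : 0 <= t -> 0 <= expR (- t) * clamp s <= 1.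
Proof.
move=> t0; case/andP: (clampP s) => c0 c1.
rewrite mulr_ge0 ?expR_ge0//= mulr_ile1 ?expR_ge0//.
by rewrite -expR0 ler_expR oppr_le0.
Qed.

Lemma dilation_linear t : linear (dilation t).
Proof.
move=> k u v; apply: C01_ext => s.
by rewrite C01D C01Z !dilationE C01D C01Z; ring.
Qed.

Lemma dilation_norm_continuous t : continuous (dilation t).
Proof.
move=> u; apply/(@cvgrPdist_lt _ _ _ _ (nbhs_filter u)) => _ /(pos_emb S)[e e0 ->].
apply/nbhs_ballP; exists (emb S (e / 2 / expR t)) => /=.
  by rewrite -(rmorph0 (emb S)) lt_emb !divr_gt0 ?expR_gt0.
move=> v; rewrite -ball_normE /ball_/= !C01_normE !lt_emb.
rewrite ltr_pdivlMr ?expR_gt0// => uv.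
apply: (@le_lt_trans _ _ (e / 2)); last lra.
apply: sup_mag_le => s _; rewrite C01B !dilationE -mulrBr magM mag_emb.
rewrite ger0_norm ?expR_ge0// mulrC; apply: le_trans (ltW uv).
by rewrite ler_wpM2r ?expR_ge0// -C01B sup_mag_ge.
Qed.

Lemma dilation_strongly_continuous u : dilation t u @[t --> 0^'+] --> u.
Proof.
apply/cvgrPdist_lt => _ /(pos_emb S)[e e0 ->].
have e4 : 0 < e / 4 by lra.
have [d d0 ud] := C01_unif_continuous u e4.
have M0 : 0 <= sup_mag u := sup_mag_ge0 u.
(* The added 1 keeps the denominator positive when [u] is zero. *)
have eM : 0 < e / 4 / (sup_mag u + 1) by rewrite divr_gt0//; lra.
have exp1 : expR t @[t --> (0:R)^'+] --> (1 : R).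
  have := @continuous_expR R 0; rewrite /continuous_at expR0.
  exact: (@cvg_at_right_filter _ _ expR).
have expN1 : expR (- t) @[t --> (0:R)^'+] --> (1 : R).
  have : expR (- t) @[t --> (0 : R)] --> expR (- (0 : R)).
    by apply: (@continuous_comp _ _ _ (@GRing.opp R) expR);
      [exact: oppr_continuous|exact: continuous_expR].
  rewrite oppr0 expR0.
  exact: (@cvg_at_right_filter _ _ (fun t => expR (- t))).
near=> t; rewrite C01_normE lt_emb.
have t1 : `|1 - expR t| < e / 4 / (sup_mag u + 1).
  by near: t; exact: ((cvgrPdist_lt _ _).1 exp1).
have t2 : `|1 - expR (- t)| < d.
  by near: t; exact: ((cvgrPdist_lt _ _).1 expN1).
apply: (@le_lt_trans _ _ (e / 2)); last lra.
apply: sup_mag_le => s /clamp_id sE; rewrite C01B dilationE.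
(* The first term moves the argument and is controlled by uniform continuity; the second changes the
   factor and is controlled by the sup norm of [u]. *)
have -> : u s - emb S (expR t) * u (expR (- t) * clamp s) =
  (u s - u (expR (- t) * clamp s)) +
  emb S (1 - expR t) * u (expR (- t) * clamp s) by rewrite rmorphB rmorph1; ring.
apply: le_trans (magD _ _ _) _; rewrite magM mag_emb.
have h1 : mag S (u s - u (expR (- t) * clamp s)) < e / 4.
  apply: ud; rewrite -{1}sE -{1}[clamp s]mul1r -mulrBl normrM.
  apply: le_lt_trans t2; rewrite ler_piMr//.
  by case/andP: (clampP s) => c0 c1; rewrite ger0_norm.
have h2 : `|1 - expR t| * mag S (u (expR (- t) * clamp s)) <= e / 4.
  move: t1; rewrite ltr_pdivlMr; last lra.
  move=> t1; apply: le_trans (ltW t1); rewrite ler_wpM2l//.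
  by have := sup_mag_ge u (expR (- t) * clamp s); lra.
lra.
Unshelve. all: by end_near. Qed.

Lemma dilation_C0 : C0_semigroup dilation.
Proof.
split=> [t t0|u|s t u s0 t0|u].
- by split; [exact: dilation_linear|exact: dilation_norm_continuous].
- apply: C01_ext => s.
  by rewrite dilationE oppr0 expR0 rmorph1 !mul1r C01_clamp.
- apply: C01_ext => r; rewrite !dilationE (clamp_id (expRN_clamp r s0)).
  rewrite opprD !expRD rmorphM -mulrA.
  by congr (_ * (_ * (u : C01 S) _)); ring.
- exact: dilation_strongly_continuous.
Qed.

End dilation_semigroup.

(** * Separability by piecewise linear interpolation *)

Section separability.
Context (R : realType) (K : numFieldType) (S : real_magnitude R K).
Implicit Types (u v : C01 S) (s x y : R).

Definition hat x : R := Num.max 0 (1 - `|x|).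

Lemma hat_ge0 x : 0 <= hat x.
Proof. by rewrite /hat le_max lexx. Qed.

Lemma hat_eq0 x : 1 <= `|x| -> hat x = 0.
Proof. by move=> x1; rewrite /hat max_l// subr_le0. Qed.

Lemma continuous_hat : continuous hat.
Proof.
move=> x; apply: (@continuous_max _ _ (fun=> 0) (fun x => 1 - `|x|)).
  exact: cvg_cst.
by apply: cvgB; [exact: cvg_cst|exact: norm_continuous].
Qed.

Lemma clampD_hat x : clamp x + hat x = clamp (x + 1).
Proof.
rewrite /hat; have [x0|x0] := leP x 0.
  rewrite (clamp_eq0 x0) ler0_norm// opprK add0r addrC.
  have [x1|x1] := leP (x + 1) 0; first by rewrite clamp_eq0.
  by rewrite clamp_id//; apply/andP; split; lra.
rewrite gtr0_norm// (clamp_eq1 (s := x + 1)); last lra.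
have [x1|x1] := leP (1 - x) 0; first by rewrite clamp_eq1; lra.
by rewrite clamp_id; [lra|apply/andP; split; lra].
Qed.

(** The sum telescopes because adding a hat shifts the ramp [clamp] by one. Hence the hats form a
    partition of unity on [0, n], where the ramp equals 1. *)
Lemma sum_hat n x :
  0 <= x -> \sum_(i < n.+1) hat (x - i%:R) = clamp (n.+1%:R - x).
Proof.
move=> x0; elim: n => [|n IH].
  rewrite big_ord1 subr0 /hat ger0_norm// /clamp min_r//; lra.
rewrite big_ord_recr /= IH.
have -> : hat (x - n.+1%:R) = hat (n.+1%:R - x) by rewrite /hat distrC.
by rewrite clampD_hat -[in RHS]natr1; congr clamp; ring.
Qed.

Lemma continuous_hat_comb m (c : nat -> K) n :
  continuous (fun s => \sum_(i < n) c i * emb S (hat (m%:R * s - i%:R))).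
Proof.
elim: n => [|n IH].
  rewrite (_ : (fun _ => _) = cst 0); first by move=> s; exact: cvg_cst.
  by apply/funext => s; rewrite big_ord0.
rewrite (_ : (fun _ => _) = (fun s =>
    \sum_(i < n) c i * emb S (hat (m%:R * s - i%:R)) +
    c n * emb S (hat (m%:R * s - n%:R)))); last first.
  by apply/funext => s; rewrite big_ord_recr.
move=> s; apply: cvgD; first exact: IH.
apply: cvgM; first exact: cvg_cst.
apply: (@cvg_comp _ _ _ (fun s => m%:R * s - n%:R)
  (fun x => emb S (hat x))); last first.
  apply: (@cvg_comp _ _ _ hat (emb S)); last exact: continuous_emb.
  exact: continuous_hat.
by apply: cvgB; [apply: cvgM; [exact: cvg_cst|exact: cvg_id]|exact: cvg_cst].
Qed.

(** The sequence lists the piecewise linear functions on uniform grids with nodal values in the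
    dense sequence [q]. A finite list of indices into [q] codes one such function, its length fixing
    the grid. *)
Lemma C01_dense_sequence : exists d : nat -> C01 S,
  forall u e, 0 < e -> exists n, sup_mag (u - d n) < e.
Proof.
have [q qP] := scalar_separable S.
pose pl (p : seq nat) : C01 S := restrict01 S
  (@continuous_hat_comb (size p).-1 (fun i => q (nth 0%N p i)) (size p)).
exists (fun n => pl (odflt [::] (unpickle n))) => u e e0.
have e4 : 0 < e / 4 by lra.
have [d d0 ud] := C01_unif_continuous u e4.
have [k] := ltr_add_invr d0; rewrite add0r => kd.
have [c cP] := choice (fun i : nat => qP (u (i%:R / k.+1%:R)) _ e4).
(* A grid of mesh 1 / (k + 1) on [0, 1] has k + 2 nodes. *)
pose p := mkseq c k.+2.
have plE s : pl p s =
    \sum_(i < k.+2) q (nth 0%N p i) * emb S (hat (k.+1%:R * clamp s - i%:R)).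
  have sp : size p = k.+2 by rewrite /p size_mkseq.
  suff -> : pl p s = \sum_(i < size p)
    q (nth 0%N p i) * emb S (hat ((size p).-1%:R * clamp s - i%:R)).
    by rewrite sp.
  by [].
exists (pickle p); rewrite pickleK [odflt _ _]/=.
apply: (@le_lt_trans _ _ (e / 2)); last lra.
apply: sup_mag_le => s s01; rewrite C01B plE (clamp_id s01).
have k0 : 0 < k.+1%:R :> R by rewrite ltr0n.
case/andP: s01 => s0 s1.
have sum1 : \sum_(i < k.+2) hat (k.+1%:R * s - i%:R) = 1.
  rewrite sum_hat; last exact: mulr_ge0.
  rewrite clamp_eq1// -natr1.
  have : k.+1%:R * s <= k.+1%:R by rewrite ler_piMr// ltW.
  lra.
have -> : u s = \sum_(i < k.+2) u s * emb S (hat (k.+1%:R * s - i%:R)).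
  by rewrite -mulr_sumr -rmorph_sum sum1 rmorph1 mulr1.
rewrite -sumrB; apply: le_trans (mag_sum S _ (fun i : nat =>
  u s * emb S (hat (k.+1%:R * s - i%:R)) -
  q (nth 0%N p i) * emb S (hat (k.+1%:R * s - i%:R)))) _.
rewrite [leRHS](_ : _ = \sum_(i < k.+2) e / 2 * hat (k.+1%:R * s - i%:R)); last first.
  by rewrite -mulr_sumr sum1 mulr1.
apply: ler_sum => i _.
rewrite -mulrBl magM mag_emb (ger0_norm (hat_ge0 _)) nth_mkseq//.
(* Only nodes closer to [s] than the mesh contribute. There e / 4 comes from uniform continuity and
   e / 4 from the approximation of the nodal value. *)
have [h1|h1] := leP 1 `|k.+1%:R * s - i%:R|; first by rewrite hat_eq0// !mulr0.
rewrite ler_wpM2r ?hat_ge0//.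
have : mag S (u s - u (i%:R / k.+1%:R)) < e / 4.
  apply: ud; apply: lt_trans kd.
  rewrite -(ltr_pM2l k0) mulfV ?gt_eqF// -{1}(gtr0_norm k0) -normrM mulrBr.
  by rewrite mulrCA mulfV ?gt_eqF// mulr1.
have := cP i; have := mag_distD S (u (i%:R / k.+1%:R)) (u s) (q (c i)); lra.
Qed.

Lemma C01_separable : separable (C01 S).
Proof.
have [d dP] := C01_dense_sequence.
exists (range d); first exact: (sub_countable (card_image_le _ _) (countableP _)).
move=> U [u Uu] oU.
have /nbhs_ballP[_ /= /(pos_emb S)[e e0 ->] eU] : nbhs u U by exact: open_nbhs_nbhs.
have [n ne] := dP u _ e0; exists (d n); split; last by exists n.
by apply: eU; rewrite -ball_normE /ball_/= C01_normE lt_emb.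
Qed.

End separability.

(** * Gluing functions with disjoint supports *)

Section glue.
Context (R : realType) (K : numFieldType) (S : real_magnitude R K).
Implicit Types (s t : R).

Lemma geometric_small (M e : R) : 0 <= M -> 0 < e ->
  exists n, M / 2 ^+ n < e.
Proof.
move=> M0 e0; exists (Num.bound (M / e)).
have := upper_nthrootP (leqnn (Num.bound (M / e))).
by rewrite ltr_pdivrMr// ltr_pdivrMr ?exprn_gt0// mulrC.
Qed.

(** The glued function is the sum of the series of the [b k]. At each point at most one term is
    nonzero, so the remainder after [n] terms is at most M / 2 ^ n and convergence is uniform. *)
Lemma glue_disjoint (P : nat -> R -> Prop) (b : nat -> R -> K) (M : R) :
  (forall i j s, P i s -> P j s -> i = j) ->
  (forall k s, ~ P k s -> b k s = 0) ->
  (forall k, continuous (b k)) ->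
  (forall k s, mag S (b k s) <= M / 2 ^+ k) ->
  exists f : R -> K, [/\ continuous f, forall k s, P k s -> f s = b k s &
    forall s, (forall k, ~ P k s) -> f s = 0].
Proof.
move=> disj b0 cb bM.
pose f s := if pselect (exists k, P k s) is left e
  then b (projT1 (cid e)) s else 0.
have fP k s : P k s -> f s = b k s.
  move=> Pks; rewrite /f; case: pselect => [e|nP]; last by case: nP; exists k.
  by case: cid => j /= Pjs; rewrite (disj _ _ _ Pjs Pks).
have f0 s : (forall k, ~ P k s) -> f s = 0.
  by move=> nP; rewrite /f; case: pselect => // e; exfalso; case: e => k /nP.
have M0 : 0 <= M.
  by have := le_trans (mag_ge0 S _) (bM 0%N 0); rewrite expr0 divr1.
exists f; split=> //.
apply: (uniform_limit_continuous_mag (S := S)) => e e0.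
have [n ne] := geometric_small M0 e0.
exists (fun s => \sum_(k < n) b k s).
  elim: {ne} n => [|n IH].
    rewrite (_ : (fun _ => _) = cst 0); first by move=> s; exact: cvg_cst.
    by apply/funext => s; rewrite big_ord0.
  rewrite (_ : (fun _ => _) = (fun s => \sum_(k < n) b k s + b n s)); last first.
    by apply/funext => s; rewrite big_ord_recr.
  by move=> s; apply: cvgD; [exact: IH|exact: cb].
move=> s; have [[k Pks]|nP] := pselect (exists k, P k s); last first.
  rewrite f0; last by move=> k Pks; apply: nP; exists k.
  rewrite big1 ?subrr ?mag0 ?ltW// => k _; apply: b0 => Pks.
  by apply: nP; exists k.
have other j : j != k -> b j s = 0.
  by move=> jk; apply: b0 => Pjs; rewrite (disj _ _ _ Pjs Pks) eqxx in jk.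
(* If the active index is below [n], the partial sum is exact; otherwise it vanishes and the error
   is the single term [b k s]. *)
rewrite (fP _ _ Pks); have [kn|nk] := ltnP k n.
  rewrite (bigD1 (Ordinal kn))//= big1 ?addr0 ?subrr ?mag0 ?ltW// => j jk.
  by apply: other; apply: contra jk => /eqP jk; apply/eqP/val_inj.
rewrite big1 ?subr0 => [|j _]; last first.
  by apply: other; rewrite ltn_eqF// (leq_trans (ltn_ord j)).
apply: le_trans (bM k s) _; apply: le_trans (ltW ne).
by rewrite ler_wpM2l// lef_pV2 ?posrE ?exprn_gt0// ler_weXn2l// ler1n.
Qed.

(* A bump equal to 1 on [2 / (n + 1), 1] and supported in [1 / (n + 1), 2]. *)
Definition cutoff n (x : R) : R := clamp (n.+1%:R * x - 1) * clamp (2 - x).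

Lemma cutoff_itv n x : 0 <= cutoff n x <= 1.
Proof.
have /andP[? ?] := clampP (n.+1%:R * x - 1).
have /andP[? ?] := clampP (2 - x).
by rewrite /cutoff mulr_ge0//= mulr_ile1.
Qed.

Lemma cutoff_eq1 n x : 2 / n.+1%:R <= x <= 1 -> cutoff n x = 1.
Proof.
rewrite ler_pdivrMr ?ltr0n// mulrC => /andP[h1 h2].
by rewrite /cutoff !clamp_eq1 ?mulr1; lra.
Qed.

Lemma cutoff_eq0 n x : ~ (n.+1%:R^-1 < x < 2) -> cutoff n x = 0.
Proof.
move=> nx; rewrite /cutoff.
have [x1|x1] := leP x n.+1%:R^-1.
  rewrite (clamp_eq0 (s := _ * _ - 1)) ?mul0r// subr_le0.
  by rewrite -ler_pdivlMl ?ltr0n// mulr1.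
rewrite (clamp_eq0 (s := 2 - x)) ?mulr0// subr_le0 leNgt.
by apply/negP => x2; apply: nx; rewrite x1.
Qed.

Lemma continuous_cutoff n : continuous (cutoff n).
Proof.
move=> x; apply: cvgM.
  apply: (@cvg_comp _ _ _ (fun x => n.+1%:R * x - 1) (@clamp R)).
    by apply: cvgB; [apply: cvgM; [exact: cvg_cst|exact: cvg_id]|exact: cvg_cst].
  exact: continuous_clamp.
apply: (@cvg_comp _ _ _ (fun x => 2 - x) (@clamp R)).
  by apply: cvgB; [exact: cvg_cst|exact: cvg_id].
exact: continuous_clamp.
Qed.

(* Rescaled copies of the g k, one in each of the disjoint intervals
   ]a k / (n k + 1), 2 a k[ accumulating at 0. *)
Lemma glue_rescaled (n : nat -> nat) (a : nat -> R) (g : nat -> C01 S) (M : R) :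
  (forall k, 0 < a k) ->
  (forall k, 2 * a k.+1 <= a k / (n k).+1%:R) ->
  (forall k, a k * sup_mag (g k) <= M / 2 ^+ k) ->
  exists v : C01 S,
    (forall k x, (n k).+1%:R^-1 < x < 2 -> 0 <= a k * x <= 1 ->
      v (a k * x) = emb S (a k * cutoff (n k) x) * g k x) /\
    (forall s, 0 <= s <= 1 ->
      (forall k, ~ ((n k).+1%:R^-1 < s / a k < 2)) -> v s = 0).
Proof.
move=> a0 a_next gM.
pose b k s := emb S (a k * cutoff (n k) (s / a k)) * g k (s / a k).
pose P k s := (n k).+1%:R^-1 < s / a k < 2.
have a_decr k : a k.+1 <= a k.
  have : a k / (n k).+1%:R <= a k.
    by rewrite ler_pdivrMr ?ltr0n// ler_peMr ?ler1n ?ltW.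
  by move=> /(le_trans (a_next k)); have := a0 k.+1; lra.
(* Later intervals lie to the left: 2 a_j <= 2 a_(i+1) <= a_i / (n_i + 1) for i < j. *)
have ltP i j s : (i < j)%N -> P i s -> P j s -> False.
  move=> ij /andP[+ _] /andP[_ +].
  rewrite ltr_pdivlMr// ltr_pdivrMr// mulrC => si sj.
  have : a j <= a i.+1.
    by rewrite -(subnKC ij); elim: (j - _)%N => [|m IH];
      rewrite ?addn0// addnS (le_trans (a_decr _)).
  by have := le_lt_trans (a_next i) (lt_trans si sj); lra.
have [||k|k s|f [cf fP f0]] := @glue_disjoint P b M.
- move=> i j s Pi Pj; have [ij|ij|//] := ltngtP i j.
    by case: (ltP _ _ _ ij Pi Pj).
  by case: (ltP _ _ _ ij Pj Pi).
- by move=> k s nP; rewrite /b cutoff_eq0// mulr0 rmorph0 mul0r.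
- have div_cvg s : (fun s => s / a k) @ s --> s / a k.
    by apply: cvgM; [exact: cvg_id|exact: cvg_cst].
  move=> s; apply: cvgM.
    apply: (@cvg_comp _ _ _ (fun s => a k * cutoff (n k) (s / a k)) (emb S)).
      apply: cvgM; first exact: cvg_cst.
      apply: (@cvg_comp _ _ _ (fun s => s / a k) (cutoff (n k)) _ _ _
        (div_cvg s)).
      exact: continuous_cutoff.
    exact: continuous_emb.
  apply: (@cvg_comp _ _ _ (fun s => s / a k) (fun x => g k x) _ _ _
    (div_cvg s)).
  exact: C01_continuous.
- apply: le_trans (gM k); rewrite /b magM mag_emb normrM gtr0_norm//.
  have /andP[c0 c1] := cutoff_itv (n k) (s / a k); rewrite ger0_norm// -mulrA.
  apply: ler_wpM2l; first exact/ltW.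
  apply: le_trans (sup_mag_ge _ (s / a k)).
  by rewrite ler_piMl ?mag_ge0.
exists (restrict01 S cf); split.
- move=> k x xP ax01; rewrite /= clamp_id//.
  have ax : a k * x / a k = x by rewrite mulrAC mulfV ?gt_eqF// mul1r.
  by rewrite (fP k) /P /b ax.
- by move=> s s01 nP; rewrite /= clamp_id//; exact: f0.
Qed.

End glue.

(** * Chaos on ]0, 1] and its failure on [0, 1] *)

Section chaos.
Context (R : realType) (K : numFieldType) (S : real_magnitude R K).
Implicit Types (u v : C01 S) (s t : R).

Lemma small_inv (d : R) :
  0 < d -> exists n0, forall n, (n0 <= n)%N -> 2 / n.+1%:R <= d.
Proof.
move=> d0; have d2 : 0 < d / 2 by lra.
have [n0] := ltr_add_invr d2; rewrite add0r => nd; exists n0 => n n0n.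
have : n.+1%:R^-1 <= n0.+1%:R^-1 :> R by rewrite lef_pV2 ?posrE ?ltr0n// ler_nat.
by move=> /le_lt_trans/(_ nd); move: n.+1%:R^-1 => x; lra.
Qed.

Lemma invr_lt_double n s : 2 / n.+1%:R <= s -> n.+1%:R^-1 < s.
Proof.
have : 0 < n.+1%:R^-1 :> R by rewrite invr_gt0.
by move: n.+1%:R^-1 => q; lra.
Qed.

(** Zooming in on [0, a] takes time [- ln a], nonnegative for [a] at most 1; this recovers the
    pattern stored at scale [a]. *)
Lemma dilation_ln a u s : 0 < a ->
  dilation (- ln a) u s = emb S a^-1 * u (a * clamp s).
Proof. by move=> a0; rewrite dilationE opprK expRN lnK. Qed.

Lemma periodic_dense :
  @dense (topologized (ptws S [set s | 0 < s]))
    (periodic_points (@dilation R K S)).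
Proof.
apply: dense_ptws_pos => u d e d0 e0.
have [n /(_ n (leqnn n)) nd] := small_inv d0.
have n0 : 0 < n.+1%:R :> R by rewrite ltr0n.
(* With this ratio consecutive intervals are adjacent: the spacing condition of [glue_rescaled]
   holds with equality. *)
pose a : R := (2 * n.+1%:R)^-1.
have a0 : 0 < a by rewrite invr_gt0 mulr_gt0.
have aE : 2 * a = n.+1%:R^-1 by rewrite /a invfM mulrA mulfV ?mul1r.
have n1 : n.+1%:R^-1 <= 1 :> R by rewrite invf_le1// ler1n.
have a2 : a <= 2^-1 by move: aE n1; move: n.+1%:R^-1 => q; lra.
have [|||v [vP v0]] :=
    @glue_rescaled R K S (fun=> n) (fun k => a ^+ k) (fun=> u) (sup_mag u).
- by move=> k; rewrite exprn_gt0.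
- by move=> k; rewrite exprS mulrA aE mulrC.
- move=> k; rewrite mulrC ler_wpM2l//.
    exact: sup_mag_ge0.
  by rewrite -exprVn lerXn2r// ?nnegrE ?ltW// invr_ge0.
have ak0 k : 0 < a ^+ k by rewrite exprn_gt0.
have ak1 k : a ^+ k <= 1 by rewrite exprn_ile1 ?ltW//; lra.
(* Multiplication by [a] carries the k-th interval to the next one. This self-similarity is what
   makes [v] a fixed point of the dilation at time [- ln a]. *)
have scale s : 0 <= s <= 1 -> v (a * s) = emb S a * v s.
  move=> /andP[s0 s1].
  have as0 : 0 <= a * s by apply: mulr_ge0 => //; exact: ltW.
  have as_le : a * s <= a by apply: ler_piMr => //; exact: ltW.
  have as01 : 0 <= a * s <= 1 by rewrite as0/=; lra.
  have [[k sk]|nP] := pselect (exists k, n.+1%:R^-1 < s / a ^+ k < 2).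
    pose x := s / a ^+ k.
    have sx : s = a ^+ k * x by rewrite mulrCA mulfV ?gt_eqF// mulr1.
    rewrite -[s in RHS]/s {2}sx (vP k)//; last by rewrite -sx s0.
    rewrite sx mulrA -exprS (vP k.+1)//; last by rewrite exprS -mulrA -sx.
    by rewrite mulrA -rmorphM mulrA -exprS.
  rewrite (v0 s) ?s0//; last by move=> k sk; apply: nP; exists k.
  (* The point a s misses interval 0 because a s <= a < 1 / (n + 1), and it misses interval k + 1
     because s misses interval k. *)
  rewrite mulr0; apply: v0 => // -[|k].
    rewrite expr0 divr1 => /andP[h _].
    by move: aE h; move: n.+1%:R^-1 => q; lra.
  rewrite exprS invfM mulrACA mulfV ?gt_eqF// mul1r => sk.
  by apply: nP; exists k.
exists v.
  exists (- ln a); first by rewrite oppr_gt0 ln_lt0// a0; lra.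
  apply: C01_ext => s; rewrite dilation_ln// scale ?clampP//.
  by rewrite mulrA -rmorphM mulVf ?gt_eqF// rmorph1 mul1r C01_clamp.
(* On [d, 1] the copy of index 0 is unscaled and its cutoff equals 1, so [v] coincides with [u]
   there. *)
move=> s /andP[ds s1].
have := vP 0%N s; rewrite expr0 mul1r => ->.
- rewrite cutoff_eq1 ?mulr1 ?rmorph1 ?mul1r ?subrr ?mag0//.
  by rewrite s1 (le_trans nd).
- by rewrite invr_lt_double ?(le_trans nd)//=; lra.
- by rewrite s1 andbT (le_trans (ltW d0)).
Qed.

Lemma universal_vector :
  exists v, @dense (topologized (ptws S [set s | 0 < s]))
    (Defs.orbit (@dilation R K S) v).
Proof.
have [d dP] := C01_dense_sequence S.
(* The 2-adic valuation of k + 1 takes every value at arbitrarily large k; for value i the witness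
   is k + 1 = 2^i (2m + 1). *)
pose j k := logn 2 k.+1.
have jP i m : exists2 k, (m <= k)%N & j k = i.
  exists (2 ^ i * (2 * m).+1).-1; rewrite /j ?prednK ?muln_gt0 ?expn_gt0//.
    rewrite -ltnS prednK ?muln_gt0 ?expn_gt0//.
    apply: (@leq_trans (2 * m).+1); first by rewrite ltnS leq_pmull.
    by rewrite leq_pmull// expn_gt0.
  rewrite lognM ?expn_gt0// pfactorK// lognE.
  case: ifP => [|_]; last by rewrite addn0.
  by rewrite /= dvdn2 /= mul2n odd_double.
(* This is 1 / (4^k k!). The factor k + 1 makes room for the k-th cutoff, which widens with k; the
   factor 4 gives both the spacing and a decay that beats the bound 2^k on the patterns. *)
pose a := fix a k : R := if k is k'.+1 then a k' / (4 * k'.+1%:R) else 1.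
have a0 k : 0 < a k by elim: k => //= k IH; rewrite divr_gt0// mulr_gt0.
have aS k : a k.+1 * 4 = a k / k.+1%:R.
  by rewrite /= invfM; move: (k.+1%:R^-1) => q; field.
have a4 k : a k <= 4^-1 ^+ k.
  elim: k => [//|k IH]; rewrite exprS.
  have : a k / k.+1%:R <= a k by rewrite ler_pdivrMr// ler_peMr ?ler1n ?ltW.
  by rewrite -aS => h; lra.
have a1 k : a k <= 1.
  by apply: le_trans (a4 k) _; rewrite exprn_ile1// ?invr_ge0//; lra.
(* Patterns too large for their scale are replaced by 0; each [d i] is still used at all large k
   with [j k] = i. *)
pose g k := if sup_mag (d (j k)) <= 2 ^+ k then d (j k) else 0.
have gM k : sup_mag (g k) <= 2 ^+ k.
  rewrite /g; case: ifP => // _; apply: sup_mag_le => s _.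
  by rewrite mag0 exprn_ge0.
have [|||v [vP _]] := @glue_rescaled R K S id a g 1 => //.
- move=> k; rewrite -aS; have := a0 k.+1; lra.
- move=> k; apply: (@le_trans _ _ (4^-1 ^+ k * 2 ^+ k)).
    apply: ler_pM => //; first exact: ltW.
    exact: sup_mag_ge0.
  rewrite mul1r -exprMn -exprVn lerXn2r// ?nnegrE; lra.
exists v; apply: dense_ptws_pos => u del e del0 e0.
have [i ui] := dP u _ e0.
have [n0 n0d] := small_inv del0.
have [m dm] : exists m : nat, sup_mag (d i) <= m%:R.
  by exists (Num.bound (sup_mag (d i))); exact/ltW/archi_boundP/sup_mag_ge0.
(* Being at least [n0] makes the cutoff 1 on [del, 1]; being at least [m] lets [d i] pass the size
   test, since m <= k < 2^k. *)
have [k mk jk] := jP i (maxn n0 m).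
move: mk; rewrite geq_max => /andP[n0k mk].
exists (dilation (- ln (a k)) v).
  by exists (- ln (a k)) => //=; rewrite oppr_ge0 ln_le0.
move=> s /andP[ds s1]; rewrite dilation_ln//.
have s0 : 0 < s by exact: lt_le_trans ds.
have nd := n0d k n0k.
have s01 : 0 <= s <= 1 by rewrite (ltW s0).
rewrite (clamp_id s01) (vP k); last first.
- have ak0 := ltW (a0 k); have s0' := ltW s0.
  by apply/andP; split; [exact: mulr_ge0|exact: mulr_ile1].
- by rewrite invr_lt_double ?(le_trans nd)//=; lra.
rewrite cutoff_eq1 ?s1 ?(le_trans nd)// mulr1 mulrA -rmorphM mulVf ?gt_eqF//.
rewrite rmorph1 mul1r /g jk ifT.
  by apply: le_lt_trans ui; rewrite -C01B sup_mag_ge.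
apply: le_trans dm _; rewrite -natrX ler_nat.
by apply: leq_trans mk (ltnW (ltn_expl _ _)).
Qed.

Lemma dilation_chaotic_pos :
  Devaney_chaotic (ptws S [set s | 0 < s]) (@dilation R K S).
Proof. by split; [exact: universal_vector|exact: periodic_dense]. Qed.

(* A periodic point u satisfies u 0 = exp(t0) * u 0, hence vanishes at 0. *)
Lemma dilation_not_chaotic : ~ Devaney_chaotic (ptws S setT) (@dilation R K S).
Proof.
(* The test set contains the constant 1 but no function vanishing at 0. *)
move=> [_ /(_ [set u : C01 S | mag S (1 - u 0) < 1])[]].
- have c1 : continuous (fun _ : R => 1 : K) by move=> s; exact: cvg_cst.
  by exists (restrict01 S c1); rewrite /= subrr mag0.
- apply/open_ptws => u /= u0; exists [:: 0], (1 - mag S (1 - u 0)); split => //.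
    by rewrite subr_gt0.
  move=> v /(_ 0); rewrite inE eqxx => /(_ isT).
  by have := mag_distD S (u 0) 1 (v 0); lra.
- move=> u [/= u0 [t t0 /(congr1 (fun v : C01 S => v 0))]].
  rewrite dilationE clamp_id ?lexx ?ler01// mulr0 => /eqP.
  rewrite -subr_eq0 -{2}[u 0]mul1r -mulrBl mulf_eq0 => /orP[|/eqP u00].
    rewrite -(rmorph1 (emb S)) -rmorphB fmorph_eq0 subr_eq0 => /eqP e1.
    by have := expR_gt1 t; rewrite e1 ltxx t0.
  by move: u0; rewrite u00 subr0 mag1 ltxx.
Qed.

Lemma chaos_example : exists (X : completeNormedModType K) (T : R -> X -> X)
      (tau1 tau2 : topology X),
    [/\ separable X, C0_semigroup T,
        linear_topology tau1 /\ hausdorff_topology tau1,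
        linear_topology tau2 /\ hausdorff_topology tau2
      & finer tau1 tau2] /\
    Devaney_chaotic tau2 T /\ ~ Devaney_chaotic tau1 T.
Proof.
exists (C01 S), (@dilation R K S), (ptws S setT), (ptws S [set s | 0 < s]).
split; last by split; [exact: dilation_chaotic_pos|exact: dilation_not_chaotic].
split.
- exact: C01_separable.
- exact: dilation_C0.
- by split; [exact: ptws_linear|exact: ptws_hausdorff].
- by split; [exact: ptws_linear|exact: ptws_hausdorff].
- exact: ptws_finer.
Qed.

End chaos.

(** * Passage to a coarser topology, and the theorem *)

Lemma Devaney_chaotic_coarser (R : realType) (X : choiceType)
    (T : R -> X -> X) (tau1 tau2 : topology X) :
  finer tau1 tau2 -> Devaney_chaotic tau1 T -> Devaney_chaotic tau2 T.
Proof.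
move=> fin; have dense_coarser (D : set X) :
    @dense (topologized tau1) D -> @dense (topologized tau2) D.
  move=> dD U U0 oU; apply: dD => //.
  by move: oU; rewrite !open_topologizedE; exact: fin.
by move=> [[x xd] pd]; split; [exists x|]; exact: dense_coarser.
Qed.

Theorem proposition3p4 (R : realType) (K : numFieldType)
    (hK : K = (R : numFieldType) \/ K = (R[i]%C : numFieldType)) :
  (forall (X : completeNormedModType K) (T : R -> X -> X)
      (tau1 tau2 : topology X),
    separable X -> C0_semigroup T ->
    linear_topology tau1 -> linear_topology tau2 -> finer tau1 tau2 ->
    Devaney_chaotic tau1 T -> Devaney_chaotic tau2 T) /\
  (exists (X : completeNormedModType K) (T : R -> X -> X)
      (tau1 tau2 : topology X),
    [/\ separable X, C0_semigroup T,
        linear_topology tau1 /\ hausdorff_topology tau1,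
        linear_topology tau2 /\ hausdorff_topology tau2
      & finer tau1 tau2] /\
    Devaney_chaotic tau2 T /\ ~ Devaney_chaotic tau1 T).
Proof.
split=> [X T tau1 tau2 _ _ _ _|]; first exact: Devaney_chaotic_coarser.
case: hK => ->; first exact: chaos_example (real_self_magnitude R).
exact: chaos_example (real_complex_magnitude R).
Qed.
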